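(* Let $(A, V, \triangleleft, \triangleright)$ and $(A', V', \triangleleft', \triangleright')$ be two matched pairs of Jordan algebras over $k$, with bicrossed products $A\bowtie V$ and $A'\bowtie' V'$. Then there exists a bijective correspondence between the set of all morphisms of Jordan algebras $\psi : A \bowtie V \to A' \bowtie' V'$ and the set of all quadruples $(r, s, t, q)$, where $r: A \to A'$, $s: A \to V'$, $t: V \to A'$, $q: V \to V'$ are linear maps satisfying the following compatibility conditions for all $a,b\in A$ and $x,y\in V$: \begin{align*} r(ab) - r(a)\, r(b) &= s(a) \triangleright' r(b) + s(b) \triangleright' r(a),\\ s(ab) - s(a)\, s(b) &= s(a) \triangleleft' r(b) + s(b) \triangleleft' r(a),\\ t(xy) - t(x)\, t(y) &= q(x) \triangleright' t(y) + q(y) \triangleright' t(x),\\ q(xy) - q(x)\, q(y) &= q(x)\triangleleft' t(y) + q(y) \triangleleft' t(x),\\ r(x \triangleright a) + t (x \triangleleft a) &= r(a)\, t(x) + s(a) \triangleright' t(x) + q(x) \triangleright' r(a),\\ s(x \triangleright a) + q (x \triangleleft a) &= s(a)\, q(x) + s(a) \triangleleft' t(x) + q(x) \triangleleft' r(a). \end{align*} Under this bijection the Jordan algebra map $\psi=\psi_{(r,s,t,q)} : A \bowtie V \to A' \bowtie' V'$ corresponding to $(r, s, t, q)$ is given for all $a\in A$, $x\in V$ by $$\psi\bigl((a,x)\bigr) = \bigl(r(a) + t(x),\ s(a) + q(x)\bigr).$$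
   Context: Throughout, $k$ is a field of characteristic $\neq 2$ and all vector spaces and (bi)linear maps are over $k$. A Jordan algebra is a vector space $A$ with a bilinear multiplication (written by juxtaposition) which is commutative, $ab=ba$, and satisfies the Jordan identity $(a^2 b)a = a^2(ba)$ for all $a,b\in A$ (no unit is required; here $a^2=aa$). Morphisms of Jordan algebras are multiplicative linear maps. A right action of a Jordan algebra $A$ on a vector space $M$ is a bilinear map $\triangleleft : M\times A\to M$ with $(x\triangleleft a^2)\triangleleft a = (x\triangleleft a)\triangleleft a^2$ for all $a\in A$, $x\in M$. A left action of $A$ on $M$ is a bilinear map $\triangleright : A\times M\to M$ with $a\triangleright(a^2\triangleright x)=a^2\triangleright(a\triangleright x)$ for all $a\in A$, $x\in M$. Let $A$, $V$ be Jordan algebras. A quadruple $(A,V,\triangleleft,\triangleright)$ is a matched pair of Jordan algebras if $\triangleleft: V\times A\to V$ is a right action of the Jordan algebra $A$ on $V$, $\triangleright: V\times A\to A$ is a left action of the Jordan algebra $V$ on $A$, and for all $a,b\in A$, $x,y\in V$: (MP1) $a(x\triangleright a^2)+(x\triangleleft a^2)\triangleright a = a^2(x\triangleright a)+(x\triangleleft a)\triangleright a^2$; (MP2) $x\triangleleft(x^2\triangleright a)+(x^2\triangleleft a)x = x^2\triangleleft(x\triangleright a)+x^2(x\triangleleft a)$; (MP3) $2\bigl[((x\triangleleft a)\triangleleft b)\triangleleft a + x\triangleleft((x\triangleright a)b)+x\triangleleft((x\triangleleft a)\triangleright b)+((x\triangleleft a)\triangleleft b)x\bigr]+(x^2\triangleleft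 b)\triangleleft a + x\triangleleft(ba^2) = 2\bigl[(x\triangleleft a)\triangleleft (ba)+(x\triangleleft a)\triangleleft(x\triangleright b)+(x\triangleleft b)\triangleleft(x\triangleright a)+(x\triangleleft a)(x\triangleleft b)\bigr]+x^2\triangleleft (ba)+(x\triangleleft b)\triangleleft a^2$; (MP4) $2\bigl[(y\triangleright(x\triangleright a))a + x\triangleright(y\triangleright(x\triangleright a))+(y\triangleleft(x\triangleright a))\triangleright a+((x\triangleleft a)y)\triangleright a\bigr]+(x^2y)\triangleright a+x\triangleright(y\triangleright a^2) = 2\bigl[(y\triangleright a)(x\triangleright a)+(xy)\triangleright(x\triangleright a)+(y\triangleleft a)\triangleright(x\triangleright a)+(x\triangleleft a)\triangleright(y\triangleright a)\bigr]+x^2\triangleright(y\triangleright a)+(xy)\triangleright a^2$; (MP5) $2\bigl[(y\triangleleft(x\triangleright a))\triangleleft a+((x\triangleleft a)y)\triangleleft a+x\triangleleft(y\triangleright(x\triangleright a))+(y\triangleleft(x\triangleright a))x+((x\triangleleft a)y)x\bigr]+(x^2y)\triangleleft a+x\triangleleft(y\triangleright a^2)+(y\triangleleft a^2)x = 2\bigl[(x\triangleleft a)\triangleleft(y\triangleright a)+(y\triangleleft a)\triangleleft(x\triangleright a)+(xy)\triangleleft(x\triangleright a)+(x\triangleleft a)(xy)+(x\triangleleft a)(y\triangleleft a)\bigr]+x^2\triangleleft(y\triangleright a)+(xy)\triangleleft a^2+x^2(y\triangleleft a)$; (MP6) $2\bigl[((x\triangleright a)b)a+((x\triangleleft a)\triangleright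 b)a+((x\triangleleft a)\triangleleft b)\triangleright a+x\triangleright((x\triangleright a)b)+x\triangleright((x\triangleleft a)\triangleright b)\bigr]+(x^2\triangleright b)a+(x^2\triangleleft b)\triangleright a+x\triangleright(a^2b) = 2\bigl[(x\triangleright a)(ab)+(x\triangleleft a)\triangleright(ba)+(x\triangleright a)(x\triangleright b)+(x\triangleleft b)\triangleright(x\triangleright a)+(x\triangleleft a)\triangleright(x\triangleright b)\bigr]+x^2\triangleright(ba)+(x\triangleleft b)\triangleright a^2+a^2(x\triangleright b)$. For a matched pair $(A,V,\triangleleft,\triangleright)$, the bicrossed product $A\bowtie V$ is the Jordan algebra with underlying vector space $A\times V$ and multiplication $$(a, x) \circ (b, y) := \bigl( a b + x \triangleright b + y\triangleright a , \ x\triangleleft b + y\triangleleft a + x y \bigr).$$ $A'\bowtie' V'$ denotes the bicrossed product of the matched pair $(A',V',\triangleleft',\triangleright')$. *)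

(* Defs.v *)
From HB Require Import structures.
From mathcomp Require Import all_boot all_algebra.

Set Implicit Arguments.
Unset Strict Implicit.
Unset Printing Implicit Defensive.

Import GRing.Theory.
Local Open Scope ring_scope.

Reserved Notation "a *j b" (at level 40, left associativity).

(* Jordan algebras over k: neither associative nor unital, so they are built on *)
(* lmodType rather than on the ring structures.                                 *)
HB.mixin Record Lmodule_isJordanAlg (k : fieldType) J of GRing.Lmodule k J := {
  jmul : {bilinear J -> J -> J};
  jmulC : forall a b : J, jmul a b = jmul b a;
  jordan_identity : forall a b : J,
    jmul (jmul (jmul a a) b) a = jmul (jmul a a) (jmul b a)
}.

#[short(type="jordanAlgType")]
HB.structure Definition JordanAlg (k : fieldType) :=
  {J of Lmodule_isJordanAlg k J & GRing.Lmodule k J}.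

Arguments jmul {k J} : rename.

Notation "a *j b" := (jmul a b) : ring_scope.

Definition jsqr (k : fieldType) (J : jordanAlgType k) (a : J) : J := a *j a.

Record jordan_morphism (k : fieldType) (J J' : jordanAlgType k) :=
  JordanMorphism {
    jordan_morphism_fun :> {linear J -> J'};
    jordan_morphismM : {morph jordan_morphism_fun : a b / a *j b}
  }.

Definition right_action (k : fieldType) (A : jordanAlgType k) (M : lmodType k)
    (act : {bilinear M -> A -> M}) : Prop :=
  forall (a : A) (x : M), act (act x (jsqr a)) a = act (act x a) (jsqr a).

Definition left_action (k : fieldType) (A : jordanAlgType k) (M : lmodType k)
    (act : {bilinear A -> M -> M}) : Prop :=
  forall (a : A) (x : M), act a (act (jsqr a) x) = act (jsqr a) (act a x).

Section MatchedPair.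
Variables (k : fieldType) (A V : jordanAlgType k).

Section Conditions.
Variables (ra : {bilinear V -> A -> V}) (la : {bilinear V -> A -> A}).

Local Notation "x <<| a" := (ra x a) (at level 40, left associativity).
Local Notation "x |>> a" := (la x a) (at level 40, left associativity).
Local Notation "a ^2" := (jsqr a) (at level 2, left associativity, format "a ^2").

Definition MP1 : Prop := forall (a : A) (x : V),
  a *j (x |>> a^2) + (x <<| a^2) |>> a = a^2 *j (x |>> a) + (x <<| a) |>> a^2.

Definition MP2 : Prop := forall (a : A) (x : V),
  x <<| (x^2 |>> a) + (x^2 <<| a) *j x = x^2 <<| (x |>> a) + x^2 *j (x <<| a).

Definition MP3 : Prop := forall (a b : A) (x : V),
  (((x <<| a) <<| b) <<| a + x <<| ((x |>> a) *j b)
     + x <<| ((x <<| a) |>> b) + ((x <<| a) <<| b) *j x) *+ 2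
    + (x^2 <<| b) <<| a + x <<| (b *j a^2)
  = ((x <<| a) <<| (b *j a) + (x <<| a) <<| (x |>> b)
     + (x <<| b) <<| (x |>> a) + (x <<| a) *j (x <<| b)) *+ 2
    + x^2 <<| (b *j a) + (x <<| b) <<| a^2.

Definition MP4 : Prop := forall (a : A) (x y : V),
  ((y |>> (x |>> a)) *j a + x |>> (y |>> (x |>> a))
     + (y <<| (x |>> a)) |>> a + ((x <<| a) *j y) |>> a) *+ 2
    + (x^2 *j y) |>> a + x |>> (y |>> a^2)
  = ((y |>> a) *j (x |>> a) + (x *j y) |>> (x |>> a)
     + (y <<| a) |>> (x |>> a) + (x <<| a) |>> (y |>> a)) *+ 2
    + x^2 |>> (y |>> a) + (x *j y) |>> a^2.

Definition MP5 : Prop := forall (a : A) (x y : V),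
  ((y <<| (x |>> a)) <<| a + ((x <<| a) *j y) <<| a + x <<| (y |>> (x |>> a))
     + (y <<| (x |>> a)) *j x + ((x <<| a) *j y) *j x) *+ 2
    + (x^2 *j y) <<| a + x <<| (y |>> a^2) + (y <<| a^2) *j x
  = ((x <<| a) <<| (y |>> a) + (y <<| a) <<| (x |>> a) + (x *j y) <<| (x |>> a)
     + (x <<| a) *j (x *j y) + (x <<| a) *j (y <<| a)) *+ 2
    + x^2 <<| (y |>> a) + (x *j y) <<| a^2 + x^2 *j (y <<| a).

Definition MP6 : Prop := forall (a b : A) (x : V),
  (((x |>> a) *j b) *j a + ((x <<| a) |>> b) *j a + ((x <<| a) <<| b) |>> a
     + x |>> ((x |>> a) *j b) + x |>> ((x <<| a) |>> b)) *+ 2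
    + (x^2 |>> b) *j a + (x^2 <<| b) |>> a + x |>> (a^2 *j b)
  = ((x |>> a) *j (a *j b) + (x <<| a) |>> (b *j a) + (x |>> a) *j (x |>> b)
     + (x <<| b) |>> (x |>> a) + (x <<| a) |>> (x |>> b)) *+ 2
    + x^2 |>> (b *j a) + (x <<| b) |>> a^2 + a^2 *j (x |>> b).

End Conditions.

Record matched_pair := MatchedPair {
  ract : {bilinear V -> A -> V};
  lact : {bilinear V -> A -> A};
  ractP : right_action ract;
  lactP : left_action lact;
  matched_pair1 : MP1 ract lact;
  matched_pair2 : MP2 ract lact;
  matched_pair3 : MP3 ract lact;
  matched_pair4 : MP4 ract lact;
  matched_pair5 : MP5 ract lact;
  matched_pair6 : MP6 ract lact
}.

End MatchedPair.


(* [pull t v] proves v = t + w for some w, if v is a sum with t as one of its   *)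
(* terms; [sum_perm] proves that two sums of the same terms are equal.          *)
Ltac pull t v :=
  lazymatch v with
  | t + ?w => constr:(erefl v)
  | ?p + t => constr:(addrC p t)
  | ?p + ?q =>
    let e := pull t q in constr:(etrans (congr1 (+%R p) e) (addrCA p t _))
  end.

Ltac sum_perm :=
  rewrite -?addrA;
  repeat match goal with
  | |- ?t + ?u = ?v =>
    let e := pull t v in refine (etrans _ (esym e)); refine (congr1 (+%R t) _)
  end;
  reflexivity.

(* One component of the Jordan identity in the bicrossed product, in terms of   *)
(* a2 = aa and x2 = xx; the other one is obtained by exchanging A and V.        *)
Lemma bicrossed_jordan_component (A V : zmodType) (m : A -> A -> A)
    (n : V -> V -> V) (l : V -> A -> A) (r : V -> A -> V)
    (a a2 b : A) (x x2 y : V) :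
  commutative m -> commutative n ->
  (forall u, {morph m u : v w / v + w}) ->
  (forall u, {morph n u : v w / v + w}) ->
  (forall u, {morph l u : v w / v + w}) ->
  (forall u, {morph l ^~ u : v w / v + w}) ->
  (forall u, {morph r u : v w / v + w}) ->
  (forall u, {morph r ^~ u : v w / v + w}) ->
  m (m a2 b) a = m a2 (m b a) -> l x (l x2 b) = l x2 (l x b) ->
  m a (l y a2) + l (r y a2) a = m a2 (l y a) + l (r y a) a2 ->
  (m (l y (l x a)) a + l x (l y (l x a)) + l (r y (l x a)) a
     + l (n (r x a) y) a) *+ 2 + l (n x2 y) a + l x (l y a2)
  = (m (l y a) (l x a) + l (n x y) (l x a) + l (r y a) (l x a)
     + l (r x a) (l y a)) *+ 2 + l x2 (l y a) + l (n x y) a2 ->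
  (m (m (l x a) b) a + m (l (r x a) b) a + l (r (r x a) b) a
     + l x (m (l x a) b) + l x (l (r x a) b)) *+ 2
    + m (l x2 b) a + l (r x2 b) a + l x (m a2 b)
  = (m (l x a) (m a b) + l (r x a) (m b a) + m (l x a) (l x b)
     + l (r x b) (l x a) + l (r x a) (l x b)) *+ 2
    + l x2 (m b a) + l (r x b) a2 + m a2 (l x b) ->
  let p := a2 + l x a *+ 2 in let q := r x a *+ 2 + x2 in
  m (m p b + l q b + l y p) a + l (r q b + r y p + n q y) a
    + l x (m p b + l q b + l y p)
  = m p (m b a + l y a + l x b) + l q (m b a + l y a + l x b)
    + l (r y a + r x b + n y x) p.
Proof.
move=> mC nC mDr nDr lDr lDl rDr rDl J L E1 E4 E6 p q; rewrite /p /q.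
have mDl u v w : m (u + v) w = m u w + m v w by rewrite !(mC _ w) mDr.
have nDl u v w : n (u + v) w = n u w + n v w by rewrite !(nC _ w) nDr.
have {}lDl u v w : l (u + v) w = l u w + l v w by exact: lDl.
have {}rDl u v w : r (u + v) w = r u w + r v w by exact: rDl.
rewrite !(mulr2n, mDl, mDr, nDl, nDr, lDl, lDr, rDl, rDr).
rewrite (mC a) in E1; rewrite (mC (l y a)) (nC x) !mulr2n in E4.
rewrite (mC a b) !mulr2n in E6.
have := congr2 +%R (congr2 +%R J L) (congr2 +%R E1 (congr2 +%R E4 E6)).
by move=> E; etransitivity; [|etransitivity; [exact: E|]]; sum_perm.
Qed.

Section Bicrossed.
Variables (k : fieldType) (A V : jordanAlgType k) (P : matched_pair A V).

Definition bicrossed of matched_pair A V : Type := (A * V)%type.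

HB.instance Definition _ := GRing.Lmodule.copy (bicrossed P) (A * V)%type.

Definition bicrossed_mul (u v : bicrossed P) : bicrossed P :=
  (u.1 *j v.1 + lact P u.2 v.1 + lact P v.2 u.1,
   ract P u.2 v.1 + ract P v.2 u.1 + u.2 *j v.2).

Lemma bicrossed_mulC u v : bicrossed_mul u v = bicrossed_mul v u.
Proof.
congr pair; first by rewrite addrAC jmulC.
by rewrite [ract P _ _ + _]addrC jmulC.
Qed.

Lemma bicrossed_mul_linear u : linear (bicrossed_mul u).
Proof.
move=> c v w; congr pair => /=; rewrite !linearPr !linearPl !scalerDr.
  by rewrite [X in X + _ = _]addrACA [LHS]addrACA.
by rewrite [X in X + _ = _]addrACA [LHS]addrACA.
Qed.

Lemma bicrossed_mul_bilinear : bilinear_for *:%R *:%R bicrossed_mul.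
Proof.
split=> u; last exact: bicrossed_mul_linear.
by move=> c v w; rewrite !(bicrossed_mulC _ u) bicrossed_mul_linear.
Qed.

HB.instance Definition _ :=
  bilinear_isBilinear.Build k (bicrossed P) (bicrossed P) (bicrossed P)
    *:%R *:%R bicrossed_mul bicrossed_mul_bilinear.

Lemma bicrossed_sqr (a : A) (x : V) :
  bicrossed_mul (a, x) (a, x) =
  (jsqr a + lact P x a *+ 2, ract P x a *+ 2 + jsqr x).
Proof. by rewrite /bicrossed_mul /= !mulr2n -addrA. Qed.

Lemma bicrossed_mul1 (u v : bicrossed P) :
  (bicrossed_mul u v).1 = lact P v.2 u.1 + lact P u.2 v.1 + u.1 *j v.1.
Proof. by rewrite /= addrC -[_ *j _ + _]addrC addrA. Qed.

Lemma bicrossed_mul2 (u v : bicrossed P) :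
  (bicrossed_mul u v).2 = u.2 *j v.2 + ract P v.2 u.1 + ract P u.2 v.1.
Proof. by rewrite /= addrC [ract P _ _ + _]addrC addrA. Qed.

Lemma bicrossed_jordan (u v : bicrossed P) :
  bicrossed_mul (bicrossed_mul (bicrossed_mul u u) v) u =
  bicrossed_mul (bicrossed_mul u u) (bicrossed_mul v u).
Proof.
case: u v => [a x] [b y]; rewrite bicrossed_sqr.
have Dr (U W X : lmodType k) (f : {bilinear U -> W -> X}) u :
  {morph f u : v w / v + w} by move=> v w; exact: linearDr.
have Dl (U W X : lmodType k) (f : {bilinear U -> W -> X}) u :
  {morph f ^~ u : v w / v + w} by move=> v w; exact: linearDl.
apply: injective_projections.
  exact: (bicrossed_jordan_component (@jmulC k A) (@jmulC k V) (Dr _ _ _ _)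
    (Dr _ _ _ _) (Dr _ _ _ (lact P)) (Dl _ _ _ (lact P)) (Dr _ _ _ (ract P))
    (Dl _ _ _ (ract P))
    (jordan_identity a b) (lactP P x b) (matched_pair1 P a y)
    (matched_pair4 P a x y) (matched_pair6 P a b x)).
rewrite !(bicrossed_mul1, bicrossed_mul2) /= [ract P x a *+ 2 + _]addrC [jsqr a + _]addrC.
apply: (@bicrossed_jordan_component _ _ jmul jmul (fun a x => ract P x a)
  (fun a x => lact P x a) x (jsqr x) y a (jsqr a) b (@jmulC k V) (@jmulC k A)
  (Dr _ _ _ _) (Dr _ _ _ _) (Dl _ _ _ (ract P)) (Dr _ _ _ (ract P))
  (Dl _ _ _ (lact P)) (Dr _ _ _ (lact P)) (jordan_identity x y) (ractP P a y)).
- rewrite jmulC addrC (matched_pair2 P b x); exact: addrC.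
- rewrite (jmulC (ract P x b)) (jmulC (jsqr a)) (jmulC a b) mulr2n.
  have := matched_pair3 P a b x; rewrite !mulr2n => E.
  by etransitivity; [|etransitivity; [exact: E|]]; sum_perm.
- rewrite (jmulC y x) !mulr2n; have := matched_pair5 P a x y.
  by rewrite !mulr2n => E; etransitivity; [|etransitivity; [exact: E|]]; sum_perm.
Qed.

HB.instance Definition _ := Lmodule_isJordanAlg.Build k (bicrossed P)
  bicrossed_mulC bicrossed_jordan.

End Bicrossed.

Section Quadruples.
Variables (k : fieldType) (A V A' V' : jordanAlgType k).
Variables (P : matched_pair A V) (P' : matched_pair A' V').

Local Notation "x <<| a" := (ract P x a) (at level 40, left associativity).
Local Notation "x |>> a" := (lact P x a) (at level 40, left associativity).
Local Notation "x <<|' a" := (ract P' x a) (at level 40, left associativity).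
Local Notation "x |>>' a" := (lact P' x a) (at level 40, left associativity).

Record compatible_quadruple := CompatibleQuadruple {
  cq_r : {linear A -> A'};
  cq_s : {linear A -> V'};
  cq_t : {linear V -> A'};
  cq_q : {linear V -> V'};
  cq_rM : forall a b : A,
    cq_r (a *j b) - cq_r a *j cq_r b
    = cq_s a |>>' cq_r b + cq_s b |>>' cq_r a;
  cq_sM : forall a b : A,
    cq_s (a *j b) - cq_s a *j cq_s b
    = cq_s a <<|' cq_r b + cq_s b <<|' cq_r a;
  cq_tM : forall x y : V,
    cq_t (x *j y) - cq_t x *j cq_t y
    = cq_q x |>>' cq_t y + cq_q y |>>' cq_t x;
  cq_qM : forall x y : V,
    cq_q (x *j y) - cq_q x *j cq_q y
    = cq_q x <<|' cq_t y + cq_q y <<|' cq_t x;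
  cq_rt : forall (a : A) (x : V),
    cq_r (x |>> a) + cq_t (x <<| a)
    = cq_r a *j cq_t x + cq_s a |>>' cq_t x + cq_q x |>>' cq_r a;
  cq_sq : forall (a : A) (x : V),
    cq_s (x |>> a) + cq_q (x <<| a)
    = cq_s a *j cq_q x + cq_s a <<|' cq_t x + cq_q x <<|' cq_r a
}.

End Quadruples.

(* Main.v *)
(* Writing (a, x) = (a, 0) + (0, x), a linear map A >< V -> A' >< V' is the same *)
(* thing as four linear maps r, s, t, q.  By bilinearity and commutativity it   *)
(* is multiplicative iff it respects the three kinds of products (a, 0)(b, 0) =  *)
(* (ab, 0), (0, x)(0, y) = (0, xy) and (a, 0)(0, x) = (x |> a, x <| a), whose   *)
(* two components are exactly the six compatibility conditions.                 *)
Require Import Defs.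
From HB Require Import structures.
From mathcomp Require Import all_boot all_algebra.
From Stdlib Require Import FunctionalExtensionality ProofIrrelevance.

Set Implicit Arguments.
Unset Strict Implicit.
Unset Printing Implicit Defensive.

Import GRing.Theory.
Local Open Scope ring_scope.

(** [A] and [V] embed in the bicrossed product as subalgebras ([bicrossed_inlM], [bicrossed_inrM])
    that span it ([bicrossed_split]), and their mixed products encode both actions
    ([bicrossed_inl_inr]). Composing a morphism with the two embeddings and taking coordinates gives
    [r], [s], [t], [q]; multiplicativity on the three kinds of products yields the six conditions.
    Conversely, [quadruple_funM] expands a general product bilinearly and recombines these
    conditions. The two passages are mutually inverse by linearity. *)

(** Bijectivity is about Leibniz equality of records that bundle functions with proofs, so pointwise
    equality has to be lifted by functional extensionality and proof irrelevance. *)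
Lemma linear_ext (R : pzRingType) (U W : lmodType R) (f g : {linear U -> W}) :
  f =1 g -> f = g.
Proof.
case: f g => [f [[f1] [f2]]] [g [[g1] [g2]]] /= /functional_extensionality efg.
case: g / efg in g1 g2 *.
by rewrite (proof_irrelevance _ g1 f1) (proof_irrelevance _ g2 f2).
Qed.

Lemma jordan_morphism_ext (k : fieldType) (J J' : jordanAlgType k)
    (f g : jordan_morphism J J') : f =1 g -> f = g.
Proof.
case: f g => [f fM] [g gM] /= /linear_ext efg.
by case: g / efg in gM *; rewrite (proof_irrelevance _ gM fM).
Qed.

Section Correspondence.
Variables (k : fieldType) (A V A' V' : jordanAlgType k).
Variables (P : matched_pair A V) (P' : matched_pair A' V').

Lemma compatible_quadruple_ext (Q Q' : compatible_quadruple P P') :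
  cq_r Q =1 cq_r Q' -> cq_s Q =1 cq_s Q' ->
  cq_t Q =1 cq_t Q' -> cq_q Q =1 cq_q Q' -> Q = Q'.
Proof.
case: Q Q' => [r s t q ? ? ? ? ? ?] [r' s' t' q' ? ? ? ? ? ?] /=.
move=> /linear_ext er /linear_ext es /linear_ext et /linear_ext eq.
by subst r' s' t' q'; f_equal; apply: proof_irrelevance.
Qed.

Section OfQuadruple.
Variable Q : compatible_quadruple P P'.

Definition quadruple_fun (u : bicrossed P) : bicrossed P' :=
  (cq_r Q u.1 + cq_t Q u.2, cq_s Q u.1 + cq_q Q u.2).

Lemma quadruple_fun_linear : linear quadruple_fun.
Proof.
by move=> c u v; congr pair => /=; rewrite !linearP scalerDr addrACA.
Qed.

HB.instance Definition _ :=
  GRing.isLinear.Build k (bicrossed P) (bicrossed P') *:%R quadruple_fun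
    quadruple_fun_linear.

Lemma quadruple_funM : {morph quadruple_fun : u v / u *j v}.
Proof.
move=> [a x] [b y]; congr pair => /=; rewrite !linearD /= !linearDl.
- have /eqP := cq_rM Q a b; rewrite subr_eq => /eqP ->.
  have /eqP := cq_tM Q x y; rewrite subr_eq => /eqP ->.
  (* The product of [(a, x)] and [(b, y)] has two mixed parts, one from [x] and [b], one from [a]
     and [y], so the mixed condition is used twice. *)
  have := congr2 +%R (cq_rt Q b x) (cq_rt Q a y).
  set X := cq_r _ (lact P x b); set Y := cq_r _ (lact P y a).
  set Z := cq_t _ _; set T := cq_t _ (ract P y a) => E.
  (* Regroup so that the left side of [E] appears as a subterm. *)
  transitivity (X + Z + (Y + T) + (cq_r Q a *j cq_r Q b
    + (lact P' (cq_s Q a) (cq_r Q b) + lact P' (cq_s Q b) (cq_r Q a)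
    + (lact P' (cq_q Q x) (cq_t Q y) + lact P' (cq_q Q y) (cq_t Q x)
    + cq_t Q x *j cq_t Q y)))); first by sum_perm.
  by rewrite E (jmulC (cq_r Q b) (cq_t Q x)); sum_perm.
(* The second coordinate follows the same pattern, with the conditions on [s] and [q]. *)
- have /eqP := cq_sM Q a b; rewrite subr_eq => /eqP ->.
  have /eqP := cq_qM Q x y; rewrite subr_eq => /eqP ->.
  have := congr2 +%R (cq_sq Q b x) (cq_sq Q a y).
  set X := cq_s _ (lact P x b); set Y := cq_s _ (lact P y a).
  set Z := cq_q _ _; set T := cq_q _ (ract P y a) => E.
  transitivity (X + Z + (Y + T) + (cq_s Q a *j cq_s Q b
    + (ract P' (cq_s Q a) (cq_r Q b) + ract P' (cq_s Q b) (cq_r Q a)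
    + (ract P' (cq_q Q x) (cq_t Q y) + ract P' (cq_q Q y) (cq_t Q x)
    + cq_q Q x *j cq_q Q y)))); first by sum_perm.
  by rewrite E (jmulC (cq_s Q b) (cq_q Q x)); sum_perm.
Qed.

Definition morphism_of_quadruple :
    jordan_morphism (bicrossed P) (bicrossed P') :=
  @JordanMorphism k (bicrossed P) (bicrossed P') quadruple_fun quadruple_funM.

End OfQuadruple.

Definition bicrossed_inl (a : A) : bicrossed P := (a, 0).
Definition bicrossed_inr (x : V) : bicrossed P := (0, x).

Lemma bicrossed_inl_linear : linear bicrossed_inl.
Proof. by move=> c a b; congr pair; rewrite /= scaler0 addr0. Qed.

Lemma bicrossed_inr_linear : linear bicrossed_inr.
Proof. by move=> c x y; congr pair; rewrite /= scaler0 addr0. Qed.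

HB.instance Definition _ :=
  GRing.isLinear.Build k A (bicrossed P) *:%R bicrossed_inl bicrossed_inl_linear.
HB.instance Definition _ :=
  GRing.isLinear.Build k V (bicrossed P) *:%R bicrossed_inr bicrossed_inr_linear.

Lemma bicrossed_split (a : A) (x : V) :
  (a, x) = bicrossed_inl a + bicrossed_inr x :> bicrossed P.
Proof. by congr pair; rewrite /= ?addr0 ?add0r. Qed.

Lemma bicrossed_inlM : {morph bicrossed_inl : a b / a *j b}.
Proof.
by move=> a b; congr pair; rewrite /= !(linear0l, linear0r) ?addr0.
Qed.

Lemma bicrossed_inrM : {morph bicrossed_inr : x y / x *j y}.
Proof.
by move=> x y; congr pair; rewrite /= !(linear0l, linear0r) ?addr0 ?add0r.
Qed.

(** All other terms of the product contain a zero factor. Applying a morphism to this identity gives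
    the two mixed conditions. *)
Lemma bicrossed_inl_inr (a : A) (x : V) :
  bicrossed_inl a *j bicrossed_inr x
  = bicrossed_inl (lact P x a) + bicrossed_inr (ract P x a).
Proof.
rewrite -bicrossed_split.
by congr pair; rewrite /= !(linear0l, linear0r) ?addr0 ?add0r.
Qed.

Section OfMorphism.
Variable f : jordan_morphism (bicrossed P) (bicrossed P').

Definition morphism_r (a : A) : A' := (f (bicrossed_inl a)).1.
Definition morphism_s (a : A) : V' := (f (bicrossed_inl a)).2.
Definition morphism_t (x : V) : A' := (f (bicrossed_inr x)).1.
Definition morphism_q (x : V) : V' := (f (bicrossed_inr x)).2.

Lemma morphism_r_linear : linear morphism_r.
Proof. by move=> c a b; rewrite /morphism_r !linearP. Qed.

Lemma morphism_s_linear : linear morphism_s.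
Proof. by move=> c a b; rewrite /morphism_s !linearP. Qed.

Lemma morphism_t_linear : linear morphism_t.
Proof. by move=> c x y; rewrite /morphism_t !linearP. Qed.

Lemma morphism_q_linear : linear morphism_q.
Proof. by move=> c x y; rewrite /morphism_q !linearP. Qed.

HB.instance Definition _ :=
  GRing.isLinear.Build k A A' *:%R morphism_r morphism_r_linear.
HB.instance Definition _ :=
  GRing.isLinear.Build k A V' *:%R morphism_s morphism_s_linear.
HB.instance Definition _ :=
  GRing.isLinear.Build k V A' *:%R morphism_t morphism_t_linear.
HB.instance Definition _ :=
  GRing.isLinear.Build k V V' *:%R morphism_q morphism_q_linear.

Definition quadruple_of_morphism : compatible_quadruple P P'.
Proof.
apply: (@CompatibleQuadruple _ _ _ _ _ P P'
          morphism_r morphism_s morphism_t morphism_q) => [a b|a b|x y|x y|a x|a x] /=;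
  rewrite /morphism_r /morphism_s /morphism_t /morphism_q.
- by rewrite bicrossed_inlM jordan_morphismM /= -[X in X - _]addrA addrAC subrr add0r.
- by rewrite bicrossed_inlM jordan_morphismM /= addrK.
- by rewrite bicrossed_inrM jordan_morphismM /= -[X in X - _]addrA addrAC subrr add0r.
- by rewrite bicrossed_inrM jordan_morphismM /= addrK.
- have /(congr1 fst) /= := jordan_morphismM f (bicrossed_inl a) (bicrossed_inr x).
  by rewrite bicrossed_inl_inr linearD.
- have /(congr1 snd) /= := jordan_morphismM f (bicrossed_inl a) (bicrossed_inr x).
  by rewrite bicrossed_inl_inr linearD /= => ->; rewrite addrC addrA.
(* Transparent, so that the four maps compute in the cancellation proofs. *)
Defined.

End OfMorphism.

Lemma morphism_of_quadrupleK :
  cancel morphism_of_quadruple quadruple_of_morphism.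
Proof.
move=> Q; apply: compatible_quadruple_ext => z /=.
- by rewrite /morphism_r /= linear0 addr0.
- by rewrite /morphism_s /= linear0 addr0.
- by rewrite /morphism_t /= linear0 add0r.
- by rewrite /morphism_q /= linear0 add0r.
Qed.

Lemma quadruple_of_morphismK :
  cancel quadruple_of_morphism morphism_of_quadruple.
Proof.
move=> f; apply: jordan_morphism_ext => -[a x].
(* Once [f] is split over the two embeddings, both sides agree by definition, since addition is
   componentwise. *)
by rewrite bicrossed_split [RHS]linearD [LHS]/= -bicrossed_split.
Qed.

End Correspondence.

Theorem theorem2p7 (k : fieldType) (char_k : 2%N \notin [pchar k])
    (A V A' V' : jordanAlgType k)
    (P : matched_pair A V) (P' : matched_pair A' V') :
  exists psi : compatible_quadruple P P' ->
               jordan_morphism (bicrossed P) (bicrossed P'),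
    bijective psi /\
    forall (Q : compatible_quadruple P P') (a : A) (x : V),
      psi Q (a, x) = (cq_r Q a + cq_t Q x, cq_s Q a + cq_q Q x).
Proof.
exists (@morphism_of_quadruple k A V A' V' P P'); split=> //.
exists (@quadruple_of_morphism k A V A' V' P P').
  exact: morphism_of_quadrupleK.
exact: quadruple_of_morphismK.
Qed.
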